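(* Let $q\in\mathbb{C}$ with $|q|<1$. For $x\in\mathbb{R}$, we have $$D_q(\sin_q x)=\cos_q x\qquad\text{and}\qquad D_q(\cos_q x)=-\sin_q x .$$ Moreover, $$D_q(\tan_q x)=1+\tan_q x\,\tan_q(qx).$$
   Context: Notation: $[n]_q=\frac{1-q^n}{1-q}=1+q+\cdots+q^{n-1}$, $[n]_q!=[n]_q\cdots[1]_q$, $[0]_q!=1$. The $q$-sine, $q$-cosine and $q$-tangent are defined by $$\sin_q x=\sum_{n=0}^{\infty}\frac{(-1)^n x^{2n+1}}{[2n+1]_q!},\qquad \cos_q x=\sum_{n=0}^{\infty}\frac{(-1)^n x^{2n}}{[2n]_q!},\qquad \tan_q x=\frac{\sin_q x}{\cos_q x}.$$ The Jackson $q$-derivative is $$D_q f(x)=\frac{f(x)-f(qx)}{(1-q)x}.$$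
   Formalization: The real x is restricted to points where the series of sin_q x and cos_q x converge (elsewhere they are undefined, e.g. q=0, x=2); the tangent formula assumes cos_q x and cos_q(qx) are nonzero; at x=0, D_q is read as the limit of the quotient. *)

(* Defs.v *)
From Stdlib Require Import Reals.
From Coquelicot Require Import Coquelicot.

Open Scope C_scope.

Definition qint (q : C) (n : nat) : C := (1 - q ^ n) / (1 - q).

Fixpoint qfact (q : C) (n : nat) : C :=
  match n with
  | O => 1
  | S m => qint q n * qfact q m
  end.

(* The functions take a complex argument: even for real [x], the operator [Dq]
   evaluates them at [q * x]. *)

Definition sinq_term (q z : C) (n : nat) : C :=
  (- (1)) ^ n * z ^ (2 * n + 1) / qfact q (2 * n + 1).

Definition cosq_term (q z : C) (n : nat) : C :=
  (- (1)) ^ n * z ^ (2 * n) / qfact q (2 * n).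

(* [z] is in the domain of the q-sine, resp. q-cosine.  Since [qfact q n] behaves
   like a nonzero constant times [(/ (1 - q)) ^ n] when [Cmod q < 1], both
   conditions amount to [Cmod ((1 - q) * z) < 1]. *)

Definition sinq_defined (q z : C) : Prop :=
  @ex_series C_AbsRing C_NormedModule (sinq_term q z).

Definition cosq_defined (q z : C) : Prop :=
  @ex_series C_AbsRing C_NormedModule (cosq_term q z).

(* [iota] picks the sum of the series; its value is unspecified outside the
   domain of convergence. *)

Definition sinq (q z : C) : C :=
  @iota C_CompleteNormedModule
    (@is_series C_AbsRing C_NormedModule (sinq_term q z)).

Definition cosq (q z : C) : C :=
  @iota C_CompleteNormedModule
    (@is_series C_AbsRing C_NormedModule (cosq_term q z)).

Definition tanq (q z : C) : C := sinq q z / cosq q z.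

Definition Dq (q : C) (f : C -> C) (x : C) : C :=
  (f x - f (q * x)) / ((1 - q) * x).

(* "The q-derivative of [f] at [x] is [l]".  The quotient [Dq q f] has no meaning
   at [0]; there the q-derivative is its limit (which is [f'(0)] whenever [f] is
   analytic at [0]). *)

Definition is_Dq (q : C) (f : C -> C) (x l : C) : Prop :=
  (x <> 0 /\ Dq q f x = l) \/
  (x = 0 /\
   filterlim (Dq q f) (@locally' C_UniformSpace (RtoC 0))
             (@locally C_UniformSpace l)).

(* Main.v *)
(** Comparing coefficients gives [sin_q (q z) = sin_q z - (1 - q) z cos_q z] and
    [cos_q (q z) = cos_q z + (1 - q) z sin_q z], together with the convergence of
    the series at [q z]; away from [0] all three formulas are algebraic consequences
    of these two functional equations.  At [0] the q-derivative is a limit, which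
    is computed from a geometric majorant of both series. *)

Require Import Defs.
From Stdlib Require Import Reals Lra Lia.
From Coquelicot Require Import Coquelicot.

Local Open Scope C_scope.

(** * Sums of convergent series as values of [iota] *)

Lemma iota_is_series (a : nat -> C) (l : C) :
  @is_series C_AbsRing C_NormedModule a l ->
  @iota C_CompleteNormedModule (@is_series C_AbsRing C_NormedModule a) = l.
Proof.
  intros H.
  apply (@iota_unique C_AbsRing C_CompleteNormedModule); [|exact H].
  intros y Hy.
  (* Limits in a normed space are unique, so [iota] can only pick [l]. *)
  exact (@filterlim_locally_unique nat C_AbsRing C_NormedModule eventually _
           _ y l Hy H).
Qed.

Lemma is_series_sinq (q z : C) : sinq_defined q z ->
  @is_series C_AbsRing C_NormedModule (sinq_term q z) (sinq q z).
Proof.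
  intros [l Hl]; unfold sinq; rewrite (iota_is_series _ _ Hl); exact Hl.
Qed.

Lemma is_series_cosq (q z : C) : cosq_defined q z ->
  @is_series C_AbsRing C_NormedModule (cosq_term q z) (cosq q z).
Proof.
  intros [l Hl]; unfold cosq; rewrite (iota_is_series _ _ Hl); exact Hl.
Qed.

(** * Nonvanishing of the q-factorials *)

Lemma one_minus_neq0 (u : C) : (Cmod u < 1)%R -> 1 - u <> 0.
Proof.
  intros Hu H0.
  assert (Hu1 : u = 1) by (replace u with (1 - (1 - u)) by ring; rewrite H0; ring).
  rewrite Hu1, Cmod_1 in Hu; lra.
Qed.

(** The bound is uniform in [n]: it keeps every [1 - q ^ S n] at distance at least [1 - Cmod q] from
    0. *)
Lemma Cmod_pow_S_le (q : C) (n : nat) : (Cmod q < 1)%R ->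
  (Cmod (q ^ S n) <= Cmod q)%R.
Proof.
  intros Hq; rewrite Cmod_pow; simpl.
  pose proof (Cmod_ge_0 q) as H0.
  assert (H1 : (Cmod q ^ n <= 1 ^ n)%R) by (apply pow_incr; lra).
  rewrite pow1 in H1; nra.
Qed.

Lemma one_minus_pow_S_neq0 (q : C) (n : nat) : (Cmod q < 1)%R -> 1 - q ^ S n <> 0.
Proof.
  intros Hq; apply one_minus_neq0.
  pose proof (Cmod_pow_S_le q n Hq); lra.
Qed.

Lemma qfact_neq0 (q : C) (n : nat) : (Cmod q < 1)%R -> qfact q n <> 0.
Proof.
  intros Hq; induction n as [|n IH].
  - exact C1_nz.
  - cbn [qfact]; unfold qint.
    repeat apply Cmult_neq_0; [| |exact IH].
    + exact (one_minus_pow_S_neq0 q n Hq).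
    (* The inverse of [1 - q] is nonzero, since its product with [1 - q] is 1. *)
    + intros H0; apply C1_nz.
      rewrite <- (Cinv_r (1 - q) (one_minus_neq0 q Hq)), H0; ring.
Qed.

(** * Functional equations relating the values at [q * z] and at [z] *)

Lemma sinq_term_mul (q z : C) (n : nat) : (Cmod q < 1)%R ->
  sinq_term q (q * z) n = sinq_term q z n - (1 - q) * z * cosq_term q z n.
Proof.
  intros Hq; unfold sinq_term, cosq_term.
  replace (2 * n + 1)%nat with (S (2 * n)) by lia.
  pose proof (one_minus_pow_S_neq0 q (2 * n) Hq) as H1.
  pose proof (one_minus_neq0 q Hq) as H2.
  pose proof (qfact_neq0 q (2 * n) Hq) as H3.
  cbn [qfact]; unfold qint.
  (* Writing q^(2n+1) = 1 - (1 - q) [2n+1]_q, the factor [2n+1]_q cancels the top factor of the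
     q-factorial and leaves a cosine term. *)
  rewrite Cpow_mult_l, (Cpow_S z), (Cpow_S q) in *.
  field; auto.
Qed.

Lemma cosq_term_mul_0 (q z : C) : cosq_term q (q * z) 0 = cosq_term q z 0.
Proof. reflexivity. Qed.

(** The same cancellation takes the exponent 2n+2 down to 2n+1, hence the shift of index; the extra
    factor -1 in the sign turns the minus of the sine case into a plus. *)
Lemma cosq_term_mul_S (q z : C) (n : nat) : (Cmod q < 1)%R ->
  cosq_term q (q * z) (S n) = cosq_term q z (S n) + (1 - q) * z * sinq_term q z n.
Proof.
  intros Hq; unfold sinq_term, cosq_term.
  replace (2 * S n)%nat with (S (2 * n + 1)) by lia.
  set (m := (2 * n + 1)%nat).
  pose proof (one_minus_pow_S_neq0 q m Hq) as H1.
  pose proof (one_minus_neq0 q Hq) as H2.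
  pose proof (qfact_neq0 q m Hq) as H3.
  cbn [qfact]; unfold qint.
  rewrite Cpow_mult_l, (Cpow_S z), (Cpow_S q), (Cpow_S (- (1))) in *.
  field; auto.
Qed.

Lemma sinq_mul (q z : C) : (Cmod q < 1)%R -> sinq_defined q z -> cosq_defined q z ->
  sinq q (q * z) = sinq q z - (1 - q) * z * cosq q z.
Proof.
  (* It suffices that the series at [q * z] converges to the right-hand side; it is termwise a
     linear combination of the two series at [z]. *)
  intros Hq Hs Hc; apply iota_is_series.
  pose proof (@is_series_minus C_AbsRing C_NormedModule _ _ _ _
    (is_series_sinq q z Hs)
    (@is_series_scal C_AbsRing C_NormedModule ((1 - q) * z) _ _
       (is_series_cosq q z Hc))) as H.
  revert H; apply is_series_ext.
  intros n; symmetry; exact (sinq_term_mul q z n Hq).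
Qed.

Lemma cosq_mul (q z : C) : (Cmod q < 1)%R -> sinq_defined q z -> cosq_defined q z ->
  cosq q (q * z) = cosq q z + (1 - q) * z * sinq q z.
Proof.
  intros Hq Hs Hc; apply iota_is_series.
  (* The constant term is split off, because sine term [n] pairs with cosine term [S n]. *)
  apply is_series_decr_1.
  assert (Hc' : @is_series C_AbsRing C_NormedModule (fun n => cosq_term q z (S n))
                  (cosq q z - cosq_term q z 0)).
  { apply is_series_incr_1.
    replace (plus _ _) with (cosq q z); [exact (is_series_cosq q z Hc)|].
    change (cosq q z = cosq q z - cosq_term q z 0 + cosq_term q z 0); ring. }
  pose proof (@is_series_plus C_AbsRing C_NormedModule _ _ _ _ Hc'
    (@is_series_scal C_AbsRing C_NormedModule ((1 - q) * z) _ _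
       (is_series_sinq q z Hs))) as H.
  change (@is_series C_AbsRing C_NormedModule (fun n => cosq_term q (q * z) (S n))
    (cosq q z + (1 - q) * z * sinq q z - cosq_term q (q * z) 0)).
  rewrite cosq_term_mul_0.
  replace (_ - _) with (cosq q z - cosq_term q z 0 + (1 - q) * z * sinq q z) by ring.
  revert H; apply is_series_ext.
  intros n; symmetry; exact (cosq_term_mul_S q z n Hq).
Qed.

(** * The three q-derivatives at a nonzero point *)

Section AwayFromZero.

Variables q z : C.
Hypothesis Hq : (Cmod q < 1)%R.
Hypothesis Hs : sinq_defined q z.
Hypothesis Hc : cosq_defined q z.
Hypothesis Hz : z <> 0.

Lemma Dq_sinq : Dq q (sinq q) z = cosq q z.
Proof.
  unfold Dq; rewrite sinq_mul by assumption.
  field; split; [exact Hz|exact (one_minus_neq0 q Hq)].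
Qed.

Lemma Dq_cosq : Dq q (cosq q) z = - sinq q z.
Proof.
  unfold Dq; rewrite cosq_mul by assumption.
  field; split; [exact Hz|exact (one_minus_neq0 q Hq)].
Qed.

(** With s, c the sine and cosine at [z] and t = (1 - q) z, the numerator s (c + t s) - c (s - t c)
    equals t (s^2 + c^2), so both sides are (s^2 + c^2) / (c (c + t s)). *)
Lemma Dq_tanq : cosq q z <> 0 -> cosq q (q * z) <> 0 ->
  Dq q (tanq q) z = 1 + tanq q z * tanq q (q * z).
Proof.
  intros H1 H2; unfold Dq, tanq.
  rewrite cosq_mul in * by assumption; rewrite sinq_mul by assumption.
  field; repeat split; auto; exact (one_minus_neq0 q Hq).
Qed.

End AwayFromZero.

(** Comparison with the geometric series gives convergence; the bound on the sum is the limit of the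
    triangle inequality for partial sums. *)
Lemma is_series_geom_bound (a : nat -> C) (M r : R) :
  (0 <= r < 1)%R -> (forall n, Cmod (a n) <= M * r ^ n)%R ->
  exists l : C, @is_series C_AbsRing C_NormedModule a l /\ (Cmod l <= M / (1 - r))%R.
Proof.
  intros Hr Ha.
  assert (Hg : is_series (fun n => M * r ^ n)%R (M / (1 - r))%R).
  { apply (@is_series_scal R_AbsRing R_NormedModule M).
    apply is_series_geom; rewrite Rabs_pos_eq; lra. }
  destruct (@ex_series_le C_AbsRing C_CompleteNormedModule a
              (fun n => M * r ^ n)%R Ha (ex_intro _ _ Hg)) as [l Hl].
  exists l; split; [exact Hl|].
  change (Rbar_le (Cmod l) (M / (1 - r))%R).
  apply (@filterlim_le nat eventually _
           (fun n => Cmod (@sum_n C_AbelianMonoid a n))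
           (sum_n (fun n => M * r ^ n)%R)).
  - exists 0%nat; intros n _.
    eapply Rle_trans;
      [exact (@norm_sum_n_m C_AbsRing C_NormedModule a 0 n)|].
    apply sum_n_m_le; exact Ha.
  - exact (filterlim_comp _ _ _ _ _ _ _ _ Hl
             (@filterlim_norm C_AbsRing C_NormedModule l)).
  - exact Hg.
Qed.

(** * Estimates near 0 and the q-derivatives at 0 *)

Section NearZero.

Variable q : C.
Hypothesis Hq : (Cmod q < 1)%R.

(* [K] bounds all the [/ [n]_q] with [n >= 1]. *)
Let K : R := (Cmod (1 - q) / (1 - Cmod q))%R.

Lemma K_pos : (0 < K)%R.
Proof.
  apply Rdiv_lt_0_compat; [|lra].
  apply Cmod_gt_0, one_minus_neq0, Hq.
Qed.

(** These are the terms of the q-exponential series: each arises from the previous one by the factor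
    z / [n+1]_q, of modulus at most [K * Cmod z]. *)
Lemma Cmod_qexp_term (z : C) (n : nat) :
  (Cmod (z ^ n / qfact q n) <= (K * Cmod z) ^ n)%R.
Proof.
  induction n as [|n IH].
  - cbn; replace (1 / 1) with (RtoC 1) by field; rewrite Cmod_1; lra.
  - pose proof (one_minus_pow_S_neq0 q n Hq) as H1.
    pose proof (one_minus_neq0 q Hq) as H2.
    pose proof (qfact_neq0 q n Hq) as H3.
    replace (z ^ S n / qfact q (S n))
      with ((1 - q) / (1 - q ^ S n) * z * (z ^ n / qfact q n)).
    2:{ cbn [qfact]; unfold qint; rewrite (Cpow_S z); field; auto. }
    rewrite !Cmod_mult; cbn [pow].
    apply Rmult_le_compat; auto using Cmod_ge_0.
    { apply Rmult_le_pos; apply Cmod_ge_0. }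
    apply Rmult_le_compat_r; [apply Cmod_ge_0|].
    rewrite Cmod_div by exact H1.
    apply Rmult_le_compat_l; [apply Cmod_ge_0|].
    apply Rinv_le_contravar; [lra|].
    pose proof (Cmod_pow_S_le q n Hq).
    (* Reverse triangle inequality: [1 - q ^ S n] has modulus at least [1 - Cmod q]. *)
    pose proof (Cmod_triangle (1 - q ^ S n) (q ^ S n)) as Ht.
    replace (1 - q ^ S n + q ^ S n) with (RtoC 1) in Ht by ring.
    rewrite Cmod_1 in Ht; lra.
Qed.

Lemma Cmod_sign (n : nat) : Cmod ((- (1)) ^ n) = 1%R.
Proof. rewrite Cmod_pow, Cmod_m1; apply pow1. Qed.

(** One factor [r] is kept, to give a bound linear in [r]; the others are replaced by 1/2, to give a
    geometric series of fixed ratio. *)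
Lemma pow_decay (r : R) (n m : nat) : (0 <= r <= /2)%R -> (n <= m)%nat ->
  (r ^ S m <= r * (/2) ^ n)%R.
Proof.
  intros Hr Hnm; cbn [pow]; apply Rmult_le_compat_l; [lra|].
  apply Rle_trans with ((/2) ^ m)%R; [apply pow_incr; lra|].
  replace m with (n + (m - n))%nat by lia; rewrite pow_add.
  assert (H : ((/2) ^ (m - n) <= 1 ^ (m - n))%R) by (apply pow_incr; lra).
  rewrite pow1 in H.
  assert (0 < (/2) ^ n)%R by (apply pow_lt; lra).
  nra.
Qed.

Lemma sinq_near_0 (z : C) : (K * Cmod z <= /2)%R ->
  sinq_defined q z /\ (Cmod (sinq q z) <= 2 * (K * Cmod z))%R.
Proof.
  intros Hr.
  assert (Hr0 : (0 <= K * Cmod z)%R)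
    by (apply Rmult_le_pos; [left; apply K_pos|apply Cmod_ge_0]).
  (* A ratio of 1/2 makes the majorant sum to twice its first term, hence the constant 2. *)
  destruct (is_series_geom_bound (sinq_term q z) (K * Cmod z) (/2)) as [l [Hl Hb]].
  - lra.
  - intros n; unfold sinq_term, Cdiv; rewrite <- Cmult_assoc.
    rewrite Cmod_mult, Cmod_sign, Rmult_1_l.
    eapply Rle_trans; [apply Cmod_qexp_term|].
    replace (2 * n + 1)%nat with (S (2 * n)) by lia.
    apply pow_decay; [lra|lia].
  - split; [exists l; exact Hl|].
    unfold sinq; rewrite (iota_is_series _ _ Hl); lra.
Qed.

Lemma cosq_near_0 (z : C) : (K * Cmod z <= /2)%R ->
  cosq_defined q z /\ (Cmod (cosq q z - 1) <= 2 * (K * Cmod z))%R.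
Proof.
  intros Hr.
  assert (Hr0 : (0 <= K * Cmod z)%R)
    by (apply Rmult_le_pos; [left; apply K_pos|apply Cmod_ge_0]).
  (* Only the series without its constant term 1 is small; its sum [l] is the cosine minus 1. *)
  destruct (is_series_geom_bound (fun n => cosq_term q z (S n)) (K * Cmod z) (/2))
    as [l [Hl Hb]].
  - lra.
  - intros n; unfold cosq_term, Cdiv; rewrite <- Cmult_assoc.
    rewrite Cmod_mult, Cmod_sign, Rmult_1_l.
    eapply Rle_trans; [apply Cmod_qexp_term|].
    replace (2 * S n)%nat with (S (S (2 * n))) by lia.
    apply pow_decay; [lra|lia].
  - assert (H : @is_series C_AbsRing C_NormedModule (cosq_term q z) (1 + l)).
    { apply is_series_decr_1.
      replace (plus _ _) with l; [exact Hl|].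
      (* Here [1 * 1 / 1] is the computed form of [cosq_term q z 0]. *)
      change (l = 1 + l + - (1 * 1 / 1)); field. }
    split; [exists (1 + l); exact H|].
    unfold cosq; rewrite (iota_is_series _ _ H).
    replace (1 + l - 1) with l by ring; lra.
Qed.

(** An error at most linear in [K * Cmod z] on a punctured disc forces the limit; the bounds near 0
    have exactly this form. *)
Lemma filterlim_at_0 (F : C -> C) (l : C) (A d : R) : (0 < d)%R ->
  (forall z : C, z <> 0 -> K * Cmod z <= d -> Cmod (F z - l) <= A * (K * Cmod z))%R ->
  filterlim F (@locally' C_UniformSpace (RtoC 0)) (@locally C_UniformSpace l).
Proof.
  intros Hd HF P HP.
  apply (@locally_norm_le_locally C_AbsRing C_NormedModule) in HP.
  destruct HP as [eps HP].
  pose proof K_pos as HK.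
  (* The sign of [A] is arbitrary; [A'] is a positive upper bound by which one may divide. *)
  set (A' := (Rabs A + 1)%R).
  assert (HA : (0 < A')%R) by (pose proof (Rabs_pos A); unfold A'; lra).
  assert (He : (0 < Rmin (d / K) (eps / (A' * K)))%R).
  { apply Rmin_pos; apply Rdiv_lt_0_compat; auto.
    - apply cond_pos.
    - apply Rmult_lt_0_compat; assumption. }
  apply (@locally_le_locally_norm C_AbsRing C_NormedModule).
  exists (mkposreal _ He); refine (fun (z : C) Hz Hz0 => _).
  change (Cmod (z - 0) < Rmin (d / K) (eps / (A' * K)))%R in Hz.
  replace (z - 0) with z in Hz by ring.
  apply HP; change (Cmod (F z - l) < eps)%R.
  assert (H1 : (Cmod z < d / K)%R) by (eapply Rlt_le_trans; [exact Hz|apply Rmin_l]).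
  assert (H2 : (Cmod z < eps / (A' * K))%R)
    by (eapply Rlt_le_trans; [exact Hz|apply Rmin_r]).
  apply Rlt_div_r in H1; [|lra].
  apply Rlt_div_r in H2; [|apply Rmult_lt_0_compat; assumption].
  eapply Rle_lt_trans; [apply HF; [exact Hz0|lra]|].
  pose proof (Cmod_ge_0 z); pose proof (Rle_abs A).
  assert (0 <= K * Cmod z)%R by (apply Rmult_le_pos; lra).
  unfold A' in *; nra.
Qed.

(** The linear bound near 0 degenerates to 0 at the origin. *)
Lemma sinq_0 : sinq q 0 = 0.
Proof.
  apply Cmod_eq_0, Rle_antisym; [|apply Cmod_ge_0].
  destruct (sinq_near_0 0) as [_ H]; rewrite Cmod_0 in *; lra.
Qed.

Lemma cosq_0 : cosq q 0 = 1.
Proof.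
  replace (cosq q 0) with (cosq q 0 - 1 + 1) by ring.
  rewrite (Cmod_eq_0 (cosq q 0 - 1)); [ring|].
  apply Rle_antisym; [|apply Cmod_ge_0].
  destruct (cosq_near_0 0) as [_ H]; rewrite Cmod_0 in *; lra.
Qed.

(** In this smaller disc the cosine is within 1/2 of 1, so its modulus is at least 1/2, and division
    by it at most doubles the bound on the sine. *)
Lemma tanq_near_0 (z : C) : (K * Cmod z <= /4)%R ->
  cosq q z <> 0 /\ (Cmod (tanq q z) <= 4 * (K * Cmod z))%R.
Proof.
  intros Hr.
  destruct (sinq_near_0 z) as [_ Hs]; [lra|].
  destruct (cosq_near_0 z) as [_ Hc]; [lra|].
  assert (Hge : (/2 <= Cmod (cosq q z))%R).
  { pose proof (Cmod_triangle (cosq q z) (- (cosq q z - 1))) as Ht.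
    replace (cosq q z + - (cosq q z - 1)) with (RtoC 1) in Ht by ring.
    rewrite Cmod_opp, Cmod_1 in Ht; lra. }
  assert (Hn : cosq q z <> 0) by (apply Cmod_gt_0; lra).
  split; [exact Hn|].
  unfold tanq; rewrite Cmod_div by exact Hn.
  apply Rle_div_l; [lra|].
  pose proof (Cmod_ge_0 (sinq q z)); nra.
Qed.

Lemma is_Dq_sinq_0 : is_Dq q (sinq q) 0 (cosq q 0).
Proof.
  right; split; [reflexivity|].
  apply (filterlim_at_0 _ _ 2 (/2)); [lra|]; intros z Hz Hr.
  destruct (sinq_near_0 z Hr) as [Hs _], (cosq_near_0 z Hr) as [Hc Hb].
  (* Off 0 the quotient is the cosine itself, so its limit is that of the cosine at 0. *)
  rewrite Dq_sinq, cosq_0 by assumption; exact Hb.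
Qed.

Lemma is_Dq_cosq_0 : is_Dq q (cosq q) 0 (- sinq q 0).
Proof.
  right; split; [reflexivity|].
  apply (filterlim_at_0 _ _ 2 (/2)); [lra|]; intros z Hz Hr.
  destruct (sinq_near_0 z Hr) as [Hs Hb], (cosq_near_0 z Hr) as [Hc _].
  rewrite Dq_cosq, sinq_0 by assumption.
  replace (- sinq q z - - 0) with (- sinq q z) by ring.
  rewrite Cmod_opp; exact Hb.
Qed.

Lemma is_Dq_tanq_0 : is_Dq q (tanq q) 0 (1 + tanq q 0 * tanq q (q * 0)).
Proof.
  right; split; [reflexivity|].
  (* With r = [K * Cmod z], the error is a product of two tangents, each of modulus at most 4 r;
     since 4 r <= 1, the product is at most 4 r. *)
  apply (filterlim_at_0 _ _ 4 (/4)); [lra|]; intros z Hz Hr.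
  destruct (sinq_near_0 z) as [Hs _]; [lra|].
  destruct (cosq_near_0 z) as [Hc _]; [lra|].
  (* Multiplication by [q] keeps the point in the disc, so the tangent bound also applies at
     [q * z]. *)
  assert (Hqz : (K * Cmod (q * z) <= K * Cmod z)%R).
  { apply Rmult_le_compat_l; [left; apply K_pos|].
    rewrite Cmod_mult; pose proof (Cmod_ge_0 z); nra. }
  destruct (tanq_near_0 z Hr) as [Hc1 Ht1].
  destruct (tanq_near_0 (q * z)) as [Hc2 Ht2]; [lra|].
  rewrite Dq_tanq by assumption.
  replace (tanq q 0) with (RtoC 0)
    by (unfold tanq; rewrite sinq_0, cosq_0; field).
  replace (1 + tanq q z * tanq q (q * z) - (1 + 0 * tanq q (q * 0)))
    with (tanq q z * tanq q (q * z)) by ring.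
  rewrite Cmod_mult.
  pose proof (Cmod_ge_0 (tanq q z)); pose proof (Cmod_ge_0 (tanq q (q * z))).
  nra.
Qed.

End NearZero.

Theorem theorem8 :
  forall (q : C), (Cmod q < 1)%R ->
  forall (x : R), sinq_defined q (RtoC x) -> cosq_defined q (RtoC x) ->
    is_Dq q (sinq q) (RtoC x) (cosq q (RtoC x)) /\
    is_Dq q (cosq q) (RtoC x) (- sinq q (RtoC x))%C /\
    (cosq q (RtoC x) <> RtoC 0 ->
     cosq q (q * RtoC x)%C <> RtoC 0 ->
     is_Dq q (tanq q) (RtoC x)
       (1 + tanq q (RtoC x) * tanq q (q * RtoC x))%C).
Proof.
  intros q Hq x Hs Hc.
  (* The two cases match the two disjuncts of [is_Dq]. *)
  destruct (Req_dec x 0) as [->|Hx].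
  - split; [|split].
    + exact (is_Dq_sinq_0 q Hq).
    + exact (is_Dq_cosq_0 q Hq).
    + intros _ _; exact (is_Dq_tanq_0 q Hq).
  - assert (Hz : RtoC x <> 0) by (intros H; apply Hx, RtoC_inj, H).
    split; [|split].
    + left; split; [exact Hz|]; apply Dq_sinq; assumption.
    + left; split; [exact Hz|]; apply Dq_cosq; assumption.
    + intros H1 H2; left; split; [exact Hz|]; apply Dq_tanq; assumption.
Qed.
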